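(* Let $G$ be a directed graph in which every vertex has finitely many out-neighbours, let $\Gamma=\mathcal{C}(G)$ be its clausal theory, and let $C\subseteq\ddot G$ be a clause. (1) $C$ is derivable from $\Gamma$ in RES extended with the rules (aW) and (bW) if and only if $\Gamma\models C$. (2) $C$ is derivable from $\Gamma$ in RES extended with the rule (cW) if and only if $\Gamma\models_c C$.
   Context: A graph is a directed graph $G=\langle G,A_G\rangle$, $A_G\subseteq G\times G$ (loops allowed). Put $A_G(x)=\{y\mid (x,y)\in A_G\}$, $A^-_G(x)=\{y\mid x\in A_G(y)\}$; for $X\subseteq G$, $A_G(X)=\bigcup_{x\in X}A_G(x)$, $A^-_G(X)=\bigcup_{x\in X}A^-_G(x)$, $A^-_G[X]=X\cup A^-_G(X)$. Vertices are propositional atoms. For $X\subseteq G$, $\ddot X=X\cup\{\overline x\mid x\in X\}$ is the set of literals over $X$ ($\overline x$ is the negation of $x$). A clause is a finite set of literals, read disjunctively; $\{\}$ is the empty clause. The clausal theory $\mathcal{C}(G)$ contains, for each $x\in G$, the clause $\{x\}\cup A_G(x)$ and, for each $y\in A_G(x)$, the clause $\{\overline x,\overline y\}$. The system RES consists of the axioms $\{a,\overline a\}$ for every atom $a\in G$ and the resolution rule: from $A\cup\{a\}$ and $B\cup\{\overline a\}$ infer $A\cup B$. $G^\bot$ is the set of atoms $x\in G$ such that both $\{x\}$ and $\{\overline x\}$ are derivable from $\Gamma$ in RES. Additional rules (all clauses are over the literals $\ddot G$): (aW) from $B$ infer $B\cup C$, provided $B\not\subseteq\ddot{G^\bot}$;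 (bW) if $A$ is a nonempty clause such that for every atom $a$ occurring (positively or negatively) in $A$ both $\{a\}$ and $\{\overline a\}$ are derived, infer $A$; (cW) from $B$ infer $B\cup C$, without restriction. A semikernel of $G$ is a set $S\subseteq G$ with $A_G(S)\subseteq A^-_G(S)\subseteq G\setminus S$; $SK(G)$ is the set of semikernels. $\mathrm{Mod}(G)$ is the set of all $S\in SK(G)$ such that $A^-_G(A^-_G[S])\subseteq A^-_G[S]$ and there is no $R\in SK(G)$ with $A^-_G(A^-_G[R])\subseteq A^-_G[R]$ and $A^-_G[S]\subsetneq A^-_G[R]$. A 3-partition of $G$ is a triple $\alpha=\langle\alpha^{\mathbf 1},\alpha^{\mathbf 0},\alpha^\bot\rangle$ of pairwise disjoint (possibly empty) sets with union $G$. For a clause $C$ with set of positively occurring atoms $P$ and set of negatively occurring atoms $N$, $\alpha\models C$ iff $P\cap\alpha^{\mathbf 1}\neq\emptyset$, or $N\cap\alpha^{\mathbf 0}\neq\emptyset$, or ($P\cup N\subseteq\alpha^\bot$ and $\alpha^\bot\neq\emptyset$). For $S\in\mathrm{Mod}(G)$ let $\alpha_S=\langle S,\,A^-_G(S),\,G\setminus A^-_G[S]\rangle$. $\Gamma\models C$ means that $\alpha_S\models C$ for every $S\in\mathrm{Mod}(G)$. $\Gamma\models_c C$ is the classical consequence relation: every classical valuation of the atoms $G$ satisfying all clauses of $\Gamma$ satisfies $C$. *)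

(* Defs.v *)
From mathcomp Require Import all_boot.
From mathcomp Require Import boolp classical_sets functions cardinality.

Set Implicit Arguments.
Unset Strict Implicit.
Unset Printing Implicit Defensive.

Local Open Scope classical_set_scope.

Section Graphs.
Context {G : Type} (A : set (G * G)).

(* [out x] is A_G(x) and [outs X] is A_G(X); [ins X] is A^-_G(X) and [insr X]
   is A^-_G[X]. *)
Definition out (x : G) : set G := [set y | A (x, y)].
Definition inn (x : G) : set G := [set y | out y x].
Definition outs (X : set G) : set G := \bigcup_(x in X) out x.
Definition ins (X : set G) : set G := \bigcup_(x in X) inn x.
Definition insr (X : set G) : set G := X `|` ins X.

Definition semikernel (S : set G) : Prop :=
  outs S `<=` ins S /\ ins S `<=` ~` S.

Definition Mod (S : set G) : Prop :=
  [/\ semikernel S,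
      ins (insr S) `<=` insr S
    & ~ exists R : set G,
        [/\ semikernel R, ins (insr R) `<=` insr R & insr S `<` insr R]].

End Graphs.

Section Clauses.
Context {G : Type}.

Inductive literal : Type := Pos of G | Neg of G.

(* Clauses are the finite sets of literals. *)
Definition is_clause (C : set literal) : Prop := finite_set C.

Definition ddot (X : set G) : set literal := Pos @` X `|` Neg @` X.

Definition pos_atoms (C : set literal) : set G := [set x | C (Pos x)].
Definition neg_atoms (C : set literal) : set G := [set x | C (Neg x)].
Definition atoms (C : set literal) : set G := pos_atoms C `|` neg_atoms C.

Definition theory (A : set (G * G)) : set (set literal) :=
  [set [set Pos x] `|` Pos @` out A x | x in [set: G]] `|`
  [set [set Neg p.1; Neg p.2] | p in A].

(* A set of rule instances: pairs of a set of premises and a conclusion. *)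
Definition rules : Type := set (set (set literal) * set literal).

Inductive derivable (Gamma : set (set literal)) (R : rules) :
    set literal -> Prop :=
| derivable_hyp C : Gamma C -> derivable Gamma R C
| derivable_rule Ps C : R (Ps, C) ->
    (forall B, Ps B -> derivable Gamma R B) -> derivable Gamma R C.

(* In [resolution], no finiteness of A and B is required: it follows from that
   of the premises.  The resolved atom may still occur in A or in B. *)
Definition axioms : rules :=
  [set r | exists a : G, r = (set0, [set Pos a; Neg a])].
Definition resolution : rules :=
  [set r | exists (a : G) (A B : set literal),
     r = ([set A `|` [set Pos a]; B `|` [set Neg a]], A `|` B)].
Definition RES : rules := axioms `|` resolution.

Definition Gbot (Gamma : set (set literal)) : set G :=
  [set x | derivable Gamma RES [set Pos x] /\ derivable Gamma RES [set Neg x]].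

Definition aW (Gamma : set (set literal)) : rules :=
  [set r | exists B C : set literal,
     [/\ is_clause C, ~ (B `<=` ddot (Gbot Gamma)) & r = ([set B], B `|` C)]].

Definition bW : rules :=
  [set r | exists A : set literal,
     [/\ is_clause A, A !=set0
       & r = ([set [set Pos a] | a in atoms A] `|`
              [set [set Neg a] | a in atoms A], A)]].

Definition cW : rules :=
  [set r | exists B C : set literal, is_clause C /\ r = ([set B], B `|` C)].

(* The three components of a 3-partition: the true, the false and the
   paradoxical atoms. *)
Record triple : Type := Triple {
  part1 : set G;
  part0 : set G;
  partbot : set G }.

Definition is_partition3 (al : triple) : Prop :=
  [/\ part1 al `&` part0 al = set0,
      part1 al `&` partbot al = set0,
      part0 al `&` partbot al = set0
    & part1 al `|` part0 al `|` partbot al = setT].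

Definition satisfies (al : triple) (C : set literal) : Prop :=
  [\/ pos_atoms C `&` part1 al !=set0,
      neg_atoms C `&` part0 al !=set0
    | pos_atoms C `|` neg_atoms C `<=` partbot al /\ partbot al !=set0].

Definition alpha (A : set (G * G)) (S : set G) : triple :=
  Triple S (ins A S) (~` insr A S).

Lemma alpha_partition3 (A : set (G * G)) (S : set G) :
  semikernel A S -> is_partition3 (alpha A S).
Proof.
move=> [_ disj]; split => /=.
- by apply/seteqP; split=> // x [Sx /disj].
- by apply/seteqP; split=> // x [Sx []]; left.
- by apply/seteqP; split=> // x [Ix []]; right.
- exact: setUv.
Qed.

(* The non-classical consequence relation for the theory of the graph A; it is
   defined from the graph, through Mod. *)
Definition entails (A : set (G * G)) (C : set literal) : Prop :=
  forall S : set G, Mod A S -> satisfies (alpha A S) C.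

Definition csatisfies (v : G -> bool) (C : set literal) : Prop :=
  exists x : G, (C (Pos x) /\ v x = true) \/ (C (Neg x) /\ v x = false).

Definition centails (Gamma : set (set literal)) (C : set literal) : Prop :=
  forall v : G -> bool,
    (forall B, Gamma B -> csatisfies v B) -> csatisfies v C.

End Clauses.

Arguments literal : clear implicits.

(* Main.v *)
Require Import Defs.
From mathcomp Require Import all_boot.
From mathcomp Require Import boolp classical_sets functions cardinality.

Local Open Scope classical_set_scope.

(* Completeness rests on a compactness-free form of resolution completeness: a
   resolution-closed set of finite clauses, none of which is included in C, has
   a model falsifying C, read off from a maximal set of literals that includes
   none of the clauses. For (cW) this is applied to all derivable clauses. For
   (aW) and (bW) it is applied to the nonempty derivable clauses over the atoms
   outside G^bot: the empty clause cannot arise from them, since resolving {a}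
   with {~a} puts a into G^bot. The true atoms of a model of these clauses form
   a semikernel R with A^-[R] = G \ G^bot. As G^bot lies outside A^-[S] for
   every S in Mod(G), by soundness of RES, maximality gives
   A^-[S] = G \ G^bot: the paradoxical atoms are exactly G^bot in every
   model. *)

(** * Finite sets and chains of sets *)

Lemma finite_set_ind (T : Type) (P : set T -> Prop) :
  P set0 -> (forall x F, P F -> P (x |` F)) ->
  forall F, finite_set F -> P F.
Proof.
move=> P0 PS F finF.
(* [{classic T}] supplies the decidable equality needed to list [F] as a sequence. *)
have /finite_seqP[s ->] : finite_set (F : set {classic T}) by [].
elim: s => [|x s IHs]; first by rewrite classical_sets.set_nil.
suff -> : [set` x :: s] = x |` [set` s] by exact: PS.
by apply/seteqP; split=> y /=; rewrite inE => /predU1P.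
Qed.

(** Finitely many members of the chain suffice to cover [D] outside [C], and the largest of them
    contains the others. The first alternative accounts for the empty chain. *)
Lemma finite_sub_bigcup_chain (T : Type) (C D : set T) (F : set (set T)) :
  total_on F subset -> finite_set D -> D `<=` C `|` \bigcup_(X in F) X ->
  D `<=` C \/ exists2 X, F X & D `<=` C `|` X.
Proof.
move=> totF finD; move: D finD; apply: finite_set_ind => [|x D IHD sub].
  by move=> _; left.
have Dsub : D `<=` C `|` \bigcup_(X in F) X by move=> y Dy; apply: sub; right.
have [Cx|[Y FY Yx]] := sub x (or_introl erefl).
  case: (IHD Dsub) => [DC|[X FX DX]]; [left|right; exists X => //].
    by move=> y [->|/DC].
  by move=> y [->|/DX//]; left.
right; case: (IHD Dsub) => [DC|[X FX DX]].
  by exists Y => // y [->|/DC]; [right|left].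
have [XY|YX] := totF X Y FX FY.
  by exists Y => // y [->|/DX[]]; [right|left|right; exact: XY].
by exists X => // y [->|/DX//]; right; exact: YX.
Qed.

(** * Literals and models of resolution-closed sets of clauses *)

Definition atom {G : Type} (l : literal G) : G :=
  match l with Pos x => x | Neg x => x end.

Definition compl {G : Type} (l : literal G) : literal G :=
  match l with Pos x => Neg x | Neg x => Pos x end.

Lemma ddotE (G : Type) (X : set G) (l : literal G) : ddot X l <-> X (atom l).
Proof.
split; first by case=> -[x Xx <-].
by case: l => x /= Xx; [left|right]; exists x.
Qed.

Lemma csatisfies_lit (G : Type) (v : G -> bool) (C : set (literal G)) l :
  C l -> (if l is Pos x then v x else ~~ v (atom l)) -> csatisfies v C.
Proof.
by case: l => x Cx /= vx; exists x; [left|right]; split=> //; apply: negbTE.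
Qed.

(* A set [M] of literals that is maximal among the supersets of [C] including
   no clause of [Delta] contains a literal of each complementary pair, and
   exactly one where [Delta] has the axiom: making its positive literals false
   satisfies [Delta]. *)
Lemma saturated_model (G : Type) (Delta : set (set (literal G)))
    (C : set (literal G)) :
  (forall D, Delta D -> finite_set D) ->
  (forall a, C (Neg a) -> Delta [set Pos a; Neg a]) ->
  (forall a D E, Delta D -> Delta E -> D (Pos a) -> E (Neg a) ->
     Delta (D `\ Pos a `|` E `\ Neg a)) ->
  (forall D, Delta D -> ~ D `<=` C) ->
  exists v : G -> bool,
    (forall D, Delta D -> csatisfies v D) /\ ~ csatisfies v C.
Proof.
move=> finD axD resD nC.
(* Uniting [M] with [C], instead of asking that [M] include [C], keeps [P] true of the empty set,
   which is the union of the empty chain. *)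
pose P M := forall D, Delta D -> ~ D `<=` C `|` M.
have [|M [PM maxM]] := @Zorn_bigcup _ P.
  move=> F FP totF D dD /(finite_sub_bigcup_chain _ _ _ _ totF (finD _ dD)).
  by case=> [/(nC _ dD)//|[X FX]]; exact: FP.
have CM : C `<=` M.
  apply: contrapT => nCM; apply: (maxM (C `|` M)).
    split; last by move=> CMM; apply: nCM => x Cx; apply: CMM; left.
    by move=> x; right.
  by move=> D dD; rewrite setUA setUid; exact: PM.
have {}PM D : Delta D -> ~ D `<=` M.
  by move=> dD DM; apply: (PM _ dD) => x /DM; right.
have addM l : ~ M l -> exists D, [/\ Delta D, D l & D `\ l `<=` M].
  move=> nMl; have /existsNP[D /not_implyP[dD /contrapT DM]] : ~ P (l |` M).
    apply: maxM; split; first by move=> x; right.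
    by move=> lMM; apply: nMl; apply: lMM; left.
  have {}DM : D `<=` l |` M by move=> x /DM[/CM|//]; right.
  exists D; split=> //; last by move=> x [/DM[xl /(_ xl)|]].
  by apply: contrapT => nDl; apply: (PM _ dD) => x Dx; case: (DM _ Dx) => // xl;
    rewrite -xl in nDl.
have M1 a : C (Neg a) -> M (Pos a) -> ~ M (Neg a).
  by move=> Ca Mp Mn; apply: (PM _ (axD _ Ca)) => x [->|->].
have M2 a : ~ M (Pos a) -> M (Neg a).
  move=> nMp; apply: contrapT => nMn.
  have [D [dD Da DM]] := addM _ nMp; have [E [dE Ea EM]] := addM _ nMn.
  by apply: (PM _ (resD _ _ _ dD dE Da Ea)) => x [/DM|/EM].
exists (fun a => `[< ~ M (Pos a) >]); split.
  move=> D dD; have /existsNP[l /not_implyP[Dl nMl]] := PM _ dD.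
  apply: (csatisfies_lit _ _ _ _ Dl); case: l Dl nMl => x Dx nMx.
    exact/asboolP.
  apply/asboolPn => /=; apply; apply: contrapT => nMp; exact/nMx/M2.
move=> [x [[/CM Mx /asboolP//]|[Cx /asboolP/contrapT Mx]]].
by apply: (M1 x) => //; exact: CM.
Qed.

(** * Derived forms of resolution, and finiteness of derivable clauses *)

Lemma derivable_resolve (G : Type) (Gamma : set (set (literal G)))
    (R : rules) a D E :
  RES `<=` R -> derivable Gamma R D -> derivable Gamma R E ->
  D (Pos a) -> E (Neg a) -> derivable Gamma R (D `\ Pos a `|` E `\ Neg a).
Proof.
move=> sR dD dE Da Ea.
apply: (@derivable_rule _ _ _ [set D; E]); last by move=> B [->|->].
apply: sR; right; exists a, (D `\ Pos a), (E `\ Neg a).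
by rewrite (setUC _ [set Pos a]) (setUC _ [set Neg a]) !setD1K.
Qed.

Lemma derivable_axiom (G : Type) (Gamma : set (set (literal G)))
    (R : rules) a : RES `<=` R -> derivable Gamma R [set Pos a; Neg a].
Proof.
by move=> sR; apply: (@derivable_rule _ _ _ set0) => //; apply: sR; left; exists a.
Qed.

Lemma derivable_sub (G : Type) (Gamma : set (set (literal G)))
    (R R' : rules) : R `<=` R' -> derivable Gamma R `<=` derivable Gamma R'.
Proof.
move=> RR' D; elim=> {D} [D dD|Ps D RD _ IH]; first exact: derivable_hyp.
by apply: (@derivable_rule _ _ _ Ps) => //; exact: RR'.
Qed.

(** Resolving against a unit clause adds no literal, so its only effect is to delete [l]. *)
Lemma derivable_remove1 (G : Type) (Gamma : set (set (literal G)))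
    (R : rules) l D : RES `<=` R ->
  derivable Gamma R D -> derivable Gamma R [set compl l] ->
  derivable Gamma R (D `\ l).
Proof.
move=> sR dD dl; have [Dl|nDl] := pselect (D l); last first.
  suff -> : D `\ l = D by [].
  by apply/seteqP; split=> [x []//|x Dx]; split=> // xl; rewrite -xl in nDl.
case: l dl Dl => x /= dl Dl.
  have := derivable_resolve _ _ _ _ _ _ sR dD dl Dl erefl.
  by rewrite setDv setU0.
have := derivable_resolve _ _ _ _ _ _ sR dl dD erefl Dl.
by rewrite setDv set0U.
Qed.

Lemma derivable_remove (G : Type) (Gamma : set (set (literal G)))
    (R : rules) D F : RES `<=` R -> finite_set F ->
  derivable Gamma R D ->
  (forall l, F l -> derivable Gamma R [set compl l]) ->
  derivable Gamma R (D `\` F).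
Proof.
move=> sR finF dD; move: F finF; apply: finite_set_ind => [_|l F IH dF].
  by rewrite setD0.
rewrite setUC -setDDl; apply: derivable_remove1 => //; last by apply: dF; left.
by apply: IH => k Fk; apply: dF; right.
Qed.

Lemma derivable_finite (G : Type) (Gamma : set (set (literal G)))
    (R : rules) : (forall D, Gamma D -> finite_set D) ->
  (forall Ps D, R (Ps, D) -> (forall B, Ps B -> finite_set B) ->
     finite_set D) ->
  forall D, derivable Gamma R D -> finite_set D.
Proof. by move=> fG fR D; elim=> {D} [D /fG//|Ps D RD _]; exact: fR. Qed.

Lemma RES_finite (G : Type) Ps (D : set (literal G)) :
  RES (Ps, D) -> (forall B, Ps B -> finite_set B) -> finite_set D.
Proof.
case=> [[a [_ ->]]//|[a [B [E [-> ->]]]] fPs].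
have := fPs _ (or_introl erefl); have := fPs _ (or_intror erefl).
by rewrite !finite_setU => -[? _] [].
Qed.

Lemma theory_finite (G : Type) (A : set (G * G)) :
  (forall x, finite_set (out A x)) ->
  forall D, theory A D -> finite_set D.
Proof.
move=> finA D [[x _ <-]|[p _ <-]] //.
by rewrite finite_setU; split=> //; exact: finite_image.
Qed.

(** * Classical consequence and the rule (cW) *)

Lemma cW_complete (G : Type) (A : set (G * G)) (C : set (literal G)) :
  (forall x, finite_set (out A x)) -> is_clause C ->
  centails (theory A) C -> derivable (theory A) (RES `|` cW) C.
Proof.
move=> finA clC entC; apply: contrapT => nC.
have sR : @RES G `<=` RES `|` cW by move=> r; left.
have [] := @saturated_model G (derivable (theory A) (RES `|` cW)) C.
- apply: derivable_finite; first exact: theory_finite.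
  move=> Ps D [/RES_finite//|[B [E [fE [-> ->]]]] fB].
  by rewrite finite_setU; split=> //; exact: fB.
- by move=> a _; exact: derivable_axiom.
- by move=> a D E; exact: derivable_resolve.
(* A derivable clause included in [C] would give [C] itself by weakening. *)
- move=> D dD DC; apply: nC.
  apply: (@derivable_rule _ _ _ [set D]); last by move=> _ ->.
  by right; exists D, C; split=> //; rewrite setUidr.
- move=> v [vD]; apply; apply: entC => B tB; apply: vD.
  exact: derivable_hyp.
Qed.

Lemma cW_sound (G : Type) (Gamma : set (set (literal G))) C :
  derivable Gamma (RES `|` cW) C -> centails Gamma C.
Proof.
move=> dC v vG; elim: dC => {C} [C /vG//|Ps C + _].
case=> [[[a [-> ->]] _|[a [D [E [-> ->]]]] IH]|[D [E [_ [-> ->]]]] IH].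
- by exists a; case: (v a); [left|right]; split=> //; [left|right].
- have [x Hx] := IH _ (or_introl erefl); have [y Hy] := IH _ (or_intror erefl).
  case: Hx => -[[Dx|[]]].
  + by move=> vx; exists x; left; split=> //; left.
  + move=> -> va; case: Hy => -[[Ey|[]] //].
    * by move=> vy; exists y; left; split=> //; right.
    * by move=> vy; exists y; right; split=> //; right.
    * by move=> ->; rewrite va.
  + by move=> vx; exists x; right; split=> //; left.
  + by [].
- have [x [[Dx vx]|[Dx vx]]] := IH _ erefl; exists x; [left|right];
    by split=> //; left.
Qed.

(** * Soundness of RES for 3-partitions *)

Definition true_lit {G : Type} (al : triple) (l : literal G) : Prop :=
  match l with Pos x => part1 al x | Neg x => part0 al x end.

Lemma satisfiesE (G : Type) (al : triple) (C : set (literal G)) :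
  satisfies al C <-> (exists2 l, C l & true_lit al l) \/
                     (C `<=` ddot (partbot al) /\ partbot al !=set0).
Proof.
split.
  case=> [[x [Cx x1]]|[x [Cx x0]]|[Cbot bot0]]; [left|left|right].
  - by exists (Pos x).
  - by exists (Neg x).
  - by split=> // -[] x Cx; apply/ddotE; apply: Cbot; [left|right].
case=> [[[] x Cx xal]|[Cbot bot0]].
- by apply: Or31; exists x.
- by apply: Or32; exists x.
- by apply: Or33; split=> // x [] /Cbot/ddotE.
Qed.

(** If the resolved literal is true in one premise, its complement is not true and its atom is not
    paradoxical, so the other premise owes its truth to a literal that survives. If both premises
    are wholly paradoxical, so is the conclusion, even when it is empty. *)
Lemma RES_satisfies (G : Type) (al : triple) Ps (C : set (literal G)) :
  is_partition3 al -> RES (Ps, C) ->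
  (forall B, Ps B -> satisfies al B) -> satisfies al C.
Proof.
move=> [I10 I1b I0b cov].
have n10 x : part1 al x -> ~ part0 al x.
  by move=> x1 x0; suff : set0 x by []; rewrite -I10.
have nb l : true_lit al l -> ~ partbot al (atom l).
  case: l => x /= xal xb; suff : set0 x by [].
    by rewrite -I1b.
  by rewrite -I0b.
case=> [[a [-> ->]] _|[a [D [E [-> ->]]]] IH].
  apply/satisfiesE; have : setT a by []; rewrite -cov => -[[a1|a0]|ab].
  - by left; exists (Pos a) => //; left.
  - by left; exists (Neg a) => //; right.
  - by right; split; [move=> l [->|->]; exact/ddotE|exists a].
apply/satisfiesE.
have /satisfiesE[[l [Dl|->] ll]|[Db b0]] := IH _ (or_introl erefl).
- by left; exists l => //; left.
- have /satisfiesE[[k [Ek|->] kk]|[Eb b0]] := IH _ (or_intror erefl).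
  + by left; exists k => //; right.
  + by case: (n10 a).
  + by case: (nb _ ll); apply/(ddotE _ _ (Neg a))/Eb; right.
- have /satisfiesE[[k [Ek|->] kk]|[Eb _]] := IH _ (or_intror erefl).
  + by left; exists k => //; right.
  + by case: (nb _ kk); apply/(ddotE _ _ (Pos a))/Db; right.
  + by right; split=> // l [Dl|El]; [apply: Db|apply: Eb]; left.
Qed.

(** The closure condition says that no edge leads from a paradoxical atom into [insr A S]. A clause
    generated at a paradoxical vertex is therefore wholly paradoxical; any other has a true
    literal. *)
Lemma theory_satisfied (G : Type) (A : set (G * G)) (S : set G) C :
  semikernel A S -> ins A (insr A S) `<=` insr A S ->
  theory A C -> satisfies (alpha A S) C.
Proof.
move=> [outS _] closS.
have botS x y : (~` insr A S) x -> A (x, y) -> (~` insr A S) y.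
  by move=> nx xy Sy; apply/nx/closS; exists y.
case=> [[x _ <-]|[[x y] /= xy <-]]; apply/satisfiesE.
  have [[Sx|[y Sy xy]]|nx] := pselect (insr A S x).
  - by left; exists (Pos x) => //; left.
  - by left; exists (Pos y) => //; right; exists y.
  - right; split; last by exists x.
    by move=> l [->|[y xy <-]]; apply/ddotE => //; exact: botS xy.
have [[Sx|Ix]|nx] := pselect (insr A S x).
- by left; exists (Neg y); [right|apply: outS; exists x].
- by left; exists (Neg x) => //; left.
- right; split; last by exists x.
  by move=> l [->|->]; apply/ddotE => //; exact: botS xy.
Qed.

Lemma derivable_satisfied (G : Type) (A : set (G * G)) (S : set G) C :
  semikernel A S -> ins A (insr A S) `<=` insr A S ->
  derivable (theory A) RES C -> satisfies (alpha A S) C.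
Proof.
move=> skS closS; elim=> {C} [C|Ps C RC _]; first exact: theory_satisfied.
exact/RES_satisfies/RC/alpha_partition3.
Qed.

Lemma Gbot_bot (G : Type) (A : set (G * G)) (S : set G) :
  semikernel A S -> ins A (insr A S) `<=` insr A S ->
  Gbot (theory A) `<=` ~` insr A S.
Proof.
move=> skS closS x [dp dn].
have /satisfiesE[[_ -> /= Sx]|[xb _]] :=
  derivable_satisfied _ _ _ _ skS closS dp; last by have /ddotE := xb _ erefl.
have /satisfiesE[[_ -> /= Ix]|[xb _]] :=
  derivable_satisfied _ _ _ _ skS closS dn; last by have /ddotE := xb _ erefl.
by case: skS => _ /(_ _ Ix).
Qed.

(** * The set G^bot, regular clauses and their models *)

Lemma Gbot_compl (G : Type) (Gamma : set (set (literal G))) l :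
  ddot (Gbot Gamma) l -> derivable Gamma RES [set compl l].
Proof. by move/ddotE; case: l => x []. Qed.

(** Resolving [{x}] with the edge clauses refutes every out-neighbour of [x]. Deleting [x] and all
    out-neighbours but [y] from the vertex clause then leaves [{y}]; finite out-degree makes this
    finitely many resolutions. *)
Lemma Gbot_out (G : Type) (A : set (G * G)) x :
  (forall x, finite_set (out A x)) -> Gbot (theory A) x ->
  out A x `<=` Gbot (theory A).
Proof.
move=> finA [dp dn].
have dN y : A (x, y) -> derivable (theory A) RES [set Neg y].
  move=> xy; have [<- //|yx] := pselect (x = y).
  have -> : [set Neg y] = [set Neg x; Neg y] `\ Neg x.
    apply/seteqP; split=> [l ->|l [[->|->]//] []//].
    by split; [right|case=> /esym].
  apply: derivable_remove1 => //.
  by apply: derivable_hyp; right; exists (x, y).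
move=> y xy; split; last exact: dN.
have dx : derivable (theory A) RES ([set Pos x] `|` Pos @` out A x).
  by apply: derivable_hyp; left; exists x.
have -> : [set Pos y] =
    ([set Pos x] `|` Pos @` out A x) `\`
    (([set Pos x] `|` Pos @` out A x) `\ Pos y).
  by rewrite setDD setUC; apply/seteqP; split=> [l ->|l []//]; split=> //;
    left; exists y.
apply: derivable_remove => //.
  by apply/finite_setD; rewrite finite_setU; split=> //; exact: finite_image.
by move=> l [[->//|[z xz <-]] _]; exact: dN.
Qed.

(** The empty clause is derivable as soon as G^bot is inhabited, so it has to be excluded for a
    model to exist. *)
Definition regular_clauses {G : Type} (Gamma : set (set (literal G))) :
    set (set (literal G)) :=
  [set D | [/\ derivable Gamma RES D, D !=set0 & D `<=` ddot (~` Gbot Gamma)]].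

Lemma regular_clauses_remove (G : Type) (A : set (G * G)) D l :
  (forall x, finite_set (out A x)) -> theory A D ->
  D l -> ~ Gbot (theory A) (atom l) ->
  regular_clauses (theory A) (D `\` ddot (Gbot (theory A))).
Proof.
move=> finA tD Dl nl; split.
- have -> : D `\` ddot (Gbot (theory A)) = D `\` (D `&` ddot (Gbot (theory A))).
    by rewrite setDIr setDv set0U.
  apply: derivable_remove => //; first exact/finite_setIl/(theory_finite _ _ finA).
    exact: derivable_hyp.
  by move=> k [_ /Gbot_compl].
- by exists l; split=> // /ddotE.
- by move=> k [_ nk]; apply/ddotE => bk; apply/nk/ddotE.
Qed.

Lemma regular_model_Mod (G : Type) (A : set (G * G)) (v : G -> bool)
    (R := [set x | ~ Gbot (theory A) x /\ v x]) :
  (forall x, finite_set (out A x)) ->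
  (forall D, regular_clauses (theory A) D -> csatisfies v D) ->
  Mod A R /\ insr A R = ~` Gbot (theory A).
Proof.
move=> finA vreg; pose bot := Gbot (theory A).
have outbot x y : bot x -> A (x, y) -> bot y.
  by move=> bx; exact: Gbot_out.
(* The edge clause without its literals over G^bot still contains [Neg x], which [v] falsifies;
   hence [Neg y] must have survived and be true. *)
have edge x y : R x -> A (x, y) -> ~ bot y /\ ~~ v y.
  move=> [nx vx] xy.
  have xy_in : theory A [set Neg x; Neg y] by right; exists (x, y).
  have /= := regular_clauses_remove _ _ _ (Neg x) finA xy_in (or_introl erefl) nx.
  move=> /vreg[z [[[[]//]]|[[[] [->] nz vz]]]]; first by rewrite vx in vz.
  by split; [move=> by_; apply/nz/ddotE|rewrite vz].
(* Likewise, a false regular [x] forces a surviving true out-neighbour in its vertex clause. *)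
have vertex x : ~ bot x -> ~~ v x -> exists2 y, R y & A (x, y).
  move=> nx nvx.
  have x_in : theory A ([set Pos x] `|` Pos @` out A x) by left; exists x.
  have /= := regular_clauses_remove _ _ _ (Pos x) finA x_in (or_introl erefl) nx.
  move=> /vreg[z [[[[[->]|[y xy [<-]]] nz vz]]|[[[//|[]//]]]]].
    by rewrite vz in nvx.
  by exists y => //; split=> // by_; apply/nz/ddotE.
have insrR : insr A R = ~` bot.
  apply/seteqP; split=> [x [[]//|[y [ny _] xy] bx]|x nx].
    exact/ny/(outbot x).
  have [vx|nvx] := boolP (v x); first by left.
  by right; have [y Ry xy] := vertex _ nx nvx; exists y.
have skR : semikernel A R.
  split=> [y [x Rx xy]|x [y Ry xy] Rx].
    have [ny nvy] := edge _ _ Rx xy.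
    by have [z Rz yz] := vertex _ ny nvy; exists z.
  by have [_] := edge _ _ Rx xy; case: Ry => _ ->.
split=> //; split=> //.
  by rewrite insrR => x [y ny xy] bx; apply/ny/(outbot x).
(* No competitor can exceed [R], since by soundness [insr A S] never meets G^bot. *)
move=> [S [skS closS [_ nSR]]]; apply: nSR; rewrite insrR => x Sx bx.
exact: (Gbot_bot _ _ _ skS closS _ bx).
Qed.

(** The restriction on [C] makes the axioms for its atoms regular, as [saturated_model] demands. *)
Lemma regular_clauses_model (G : Type) (A : set (G * G)) C :
  (forall x, finite_set (out A x)) ->
  C `<=` ddot (~` Gbot (theory A)) ->
  (forall D, regular_clauses (theory A) D -> ~ D `<=` C) ->
  exists v : G -> bool,
    (forall D, regular_clauses (theory A) D -> csatisfies v D) /\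
    ~ csatisfies v C.
Proof.
move=> finA Creg; apply: saturated_model.
- move=> D [dD _ _]; apply: derivable_finite dD; first exact: theory_finite.
  exact: RES_finite.
- move=> a /Creg/ddotE na; split; first exact: derivable_axiom.
    by exists (Pos a); left.
  by move=> l [->|->]; exact/ddotE.
- move=> a D E [dD _ Dreg] [dE _ Ereg] Da Ea; split.
  + exact: derivable_resolve.
  + apply: contrapT => /set0P/negP/negPn/eqP; rewrite setU_eq0 => -[D0 E0].
    have /ddotE := Dreg _ Da; apply; split.
      by rewrite -(setD1K Da) D0 setU0 in dD.
    by rewrite -(setD1K Ea) E0 setU0 in dE.
  + by move=> l [[/Dreg]|[/Ereg]].
Qed.

Lemma exists_regular_model (G : Type) (A : set (G * G)) :
  (forall x, finite_set (out A x)) ->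
  exists v : G -> bool,
    forall D, regular_clauses (theory A) D -> csatisfies v D.
Proof.
move=> finA; have [//|D|v [vreg _]] := regular_clauses_model _ A set0 finA.
  by move=> [_ [l Dl] _] /(_ _ Dl).
by exists v.
Qed.

Lemma Mod_insr (G : Type) (A : set (G * G)) S :
  (forall x, finite_set (out A x)) -> Mod A S -> insr A S = ~` Gbot (theory A).
Proof.
move=> finA [skS closS maxS].
have [v /(regular_model_Mod _ _ _ finA)[[skR closR _] insrR]] :=
  exists_regular_model _ _ finA.
have SR : insr A S `<=` ~` Gbot (theory A).
  by move=> x Sx bx; exact: (Gbot_bot _ _ _ skS closS _ bx).
apply: contrapT => neq; apply: maxS.
exists [set x | ~ Gbot (theory A) x /\ v x]; split=> //.
rewrite insrR; split=> // RS; apply: neq; exact/seteqP.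
Qed.

(** * Soundness and completeness of (aW) and (bW) *)

Lemma abW_sound (G : Type) (A : set (G * G)) C :
  (forall x, finite_set (out A x)) ->
  derivable (theory A) (RES `|` aW (theory A) `|` bW) C -> entails A C.
Proof.
move=> finA dC S ModS; have [skS closS _] := ModS.
have Sbot x : (~` insr A S) x -> Gbot (theory A) x.
  by rewrite (Mod_insr _ _ _ finA ModS) setCK.
elim: dC => {C} [C|Ps C + _]; first exact: theory_satisfied.
case=> [[RC|[B [E [_ Breg [-> ->]]]] IH]|[D [_ [l Dl] [-> ->]]] IH].
- exact/RES_satisfies/RC/alpha_partition3.
(* The premise has an atom outside G^bot, hence not paradoxical, so it has a true literal, and this
   survives weakening. *)
- apply/satisfiesE; left.
  have /satisfiesE[[l Bl ll]|[Bb _]] := IH _ erefl.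
    by exists l => //; left.
  by case: Breg => l /Bb/ddotE bl; apply/ddotE/Sbot.
- have Db x : atoms D x -> (~` insr A S) x.
    move=> Dx.
    have /satisfiesE[[_ -> /= Sx]|[xb _]] :=
      IH [set Pos x] (or_introl (ex_intro2 _ _ x Dx erefl));
      last by have /ddotE := xb _ erefl.
    have /satisfiesE[[_ -> /= Ix]|[xb _]] :=
      IH [set Neg x] (or_intror (ex_intro2 _ _ x Dx erefl));
      last by have /ddotE := xb _ erefl.
    by case: skS => _ /(_ _ Ix).
  apply: Or33; split=> //; exists (atom l); apply: Db.
  by case: l Dl => x Dx; [left|right].
Qed.

(** A nonempty [C] over G^bot comes from (bW). A [C] with an atom outside G^bot comes by (aW) from a
    regular clause included in it; were there none, a model of the regular clauses would refute
    [C]. *)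
Lemma abW_complete (G : Type) (A : set (G * G)) C :
  (forall x, finite_set (out A x)) -> is_clause C -> entails A C ->
  derivable (theory A) (RES `|` aW (theory A) `|` bW) C.
Proof.
move=> finA clC entC; pose bot := Gbot (theory A).
have sR : RES `<=` RES `|` aW (theory A) `|` bW by move=> r; left; left.
have dbot x : bot x ->
    derivable (theory A) (RES `|` aW (theory A) `|` bW) [set Pos x] /\
    derivable (theory A) (RES `|` aW (theory A) `|` bW) [set Neg x].
  by case; split; exact: (derivable_sub _ _ _ _ sR).
have [Cbot|nCbot] := pselect (C `<=` ddot bot).
  have [[l Cl]|/set0P/negP/negPn/eqP C0] := pselect (C !=set0).
    apply: (@derivable_rule _ _ _ _ _ (or_intror (ex_intro _ C _))).
      by split=> //; exists l.
    by move=> B [[x Cx <-]|[x Cx <-]]; have [] := dbot x _;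
      case: Cx => /Cbot/ddotE.
  (* The empty clause can hold in a model only through a paradoxical atom [x]; resolving [{x}] with
     its negation then derives it. *)
  have [v /(regular_model_Mod _ _ _ finA)[ModR insrR]] :=
    exists_regular_model _ _ finA.
  have /satisfiesE[[l]|[_ [x /=]]] := entC _ ModR; first by rewrite C0.
  rewrite insrR => /contrapT/dbot[dp dn].
  have := derivable_remove1 _ _ _ (Pos x) _ sR dp dn.
  by rewrite setDv C0.
have [[D [[dD [l Dl] Dreg] DC]]|noD] :=
    pselect (exists D, regular_clauses (theory A) D /\ D `<=` C).
  apply: (@derivable_rule _ _ _ [set D]).
    left; right; exists D, C; split=> //; last by rewrite setUidr.
    by move=> /(_ _ Dl)/ddotE; have /ddotE := Dreg _ Dl.
  by move=> _ ->; exact: (derivable_sub _ _ _ _ sR).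
(* Falsifying the regular part of [C] is enough: literals over G^bot are not true in the resulting
   model. *)
have [|D Dreg DC|v [vreg nvC]] :=
    regular_clauses_model _ A (C `&` ddot (~` bot)) finA.
- by move=> l [].
- by apply: noD; exists D; split=> // l /DC[].
have [ModR insrR] := regular_model_Mod _ _ _ finA vreg.
have /satisfiesE[[[] x Cx /= xR]|[Cb _]] := entC _ ModR.
- case: nvC; apply: (csatisfies_lit _ _ _ (Pos x)); last by case: xR.
  by split=> //; apply/ddotE; case: xR.
- have nx : ~ bot x.
    by suff : insr A [set x | ~ bot x /\ v x] x; [rewrite insrR|right].
  case: nvC; apply: (csatisfies_lit _ _ _ (Neg x)).
    by split=> //; exact/ddotE.
  apply/negP => vx; have [[_ dis] _ _] := ModR.
  exact: (dis _ xR).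
- by case: nCbot; move: Cb; rewrite /= insrR setCK.
Qed.

Theorem mainTheorem3 (G : Type) (A : set (G * G))
    (finA : forall x : G, finite_set (out A x))
    (C : set (literal G)) (clC : is_clause C) :
  (derivable (theory A) (RES `|` aW (theory A) `|` bW) C <-> entails A C) /\
  (derivable (theory A) (RES `|` cW) C <-> centails (theory A) C).
Proof.
split; split.
- exact: abW_sound.
- exact: abW_complete.
- exact: cW_sound.
- exact: cW_complete.
Qed.
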